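(* Let $T=(T_m)_{m\in\mathbb Z}$ be an ergodic measure preserving $\mathbb Z$-action of rank at most $k_1$ on a standard $\sigma$-finite measure space $(X,\mathfrak B,\mu)$. Let $k\le k_1$ and let $(B_n^j)_{n\ge0}$, $(F_n^j)_{n\ge0}$, $1\le j\le k$, be sequences as in the definition of rank at most $k$ such that the corresponding sequence of $T$-castles refines and the limits $$\lim_{n\to\infty}\mu\Big(\Big(\bigsqcup_{i=1}^kB_0^i\Big)\cap W_n^j\Big)=\delta_j>0,\quad j=1,\dots,k,$$ exist with $\sum_{j=1}^k\delta_j=\sum_{j=1}^k\mu(B_0^j)$. Then the induced (finite measure preserving) transformation $(T_1)_{\bigsqcup_{i=1}^kB_0^i}$ is of exact rank at most $k$.
   Context: **Rank at most $k$.** A measure preserving $\mathbb Z$-action $T$ on a standard (non-atomic) $\sigma$-finite space $(X,\mathfrak B,\mu)$ is of rank at most $k$ if there are sequences $(B_n^j)_{n\ge0}$, $j=1,\dots,k$, of sets of finite measure, and sets $F_n^j=\{0,1,\dots,\#F_n^j-1\}$ such that: (i) for each $n$, the sets $T_gB_n^j$, $g\in F_n^j$, $1\le j\le k$, are pairwise disjoint; (ii) for each $B\in\mathfrak B$ with $\mu(B)<\infty$, $\lim_{n\to\infty}\inf_{F^j\subset F_n^j}\mu\big(B\triangle\bigsqcup_{j=1}^k\bigsqcup_{g\in F^j}T_gB_n^j\big)=0$. It is also assumed (without loss of generality) that $\mu(B_n^j)\to0$ for each $j$. The collection $\{T_gB_n^j:g\in F_n^j\}$ is the $j$-th $T$-tower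 of the $n$-th $T$-castle, its members are levels, $W_n^j$ is the union of its levels. The sequence of castles refines if for each $n$ every level of the $n$-th castle is a union of levels of the $(n+1)$-th castle. **Exact rank at most $k$** (for a finite measure preserving transformation $S$ of a standard non-atomic space $(Y,\mathfrak C,\nu)$): there are sequences $(D_n^j)_{n\ge0}$, $j=1,\dots,k$, of measurable subsets of $Y$ with $\nu(D_n^j)\to0$ for each $j$, and sets $H_n^j=\{0,1,\dots,\#H_n^j-1\}$ such that for each $n$ the sets $S^gD_n^j$, $g\in H_n^j$, $1\le j\le k$, are pairwise disjoint; for each $B\in\mathfrak C$, $\lim_{n\to\infty}\inf_{H^j\subset H_n^j}\nu\big(B\triangle\bigsqcup_{j=1}^k\bigsqcup_{g\in H^j}S^gD_n^j\big)=0$; and, in addition, writing $V_n^j=\bigsqcup_{g\in H_n^j}S^gD_n^j$, one has $\nu(Y\setminus\bigsqcup_{j=1}^kV_n^j)=0$ for all $n$, and some $\delta>0$ with $\nu(V_n^j)>\delta$ for all $n,j$. The induced transformation of $T_1$ on a set $Y$ of positive measure is the first return map to $Y$. *)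

(* Defs.v *)
From HB Require Import structures.
From mathcomp Require Import all_boot all_order all_algebra.
From mathcomp Require Import all_classical all_reals all_analysis.

Set Implicit Arguments.
Unset Strict Implicit.
Unset Printing Implicit Defensive.

Import Order.TTheory GRing.Theory Num.Theory.
Import numFieldNormedType.Exports.

Local Open Scope classical_set_scope.
Local Open Scope ring_scope.
Local Open Scope ereal_scope.

(* Measurably isomorphic to a Polish space with its Borel sigma-algebra.  R only
   supplies the values of the metric. *)
Definition standard_borel (R : realType) d (X : measurableType d) : Prop :=
  exists P : completePseudoMetricType R,
    [/\ hausdorff_space P,
        (exists2 D : set P, countable D & dense D) &
        exists2 f : X -> P, bijective f &
          forall A : set X,
            measurable A <-> <<s [set U : set P | open U] >> (f @` A)].

Section Definitions.
Context (R : realType) d (X : measurableType d).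
Implicit Types (mu : {measure set X -> \bar R}) (T : int -> X -> X)
  (S : X -> X) (Y : set X).

Definition atom mu (A : set X) : Prop :=
  [/\ measurable A, 0 < mu A &
      forall B : set X, measurable B -> B `<=` A ->
        mu B = 0 \/ mu (A `\` B) = 0].

Definition nonatomic mu : Prop := forall A : set X, ~ atom mu A.

Definition mp_action mu T : Prop :=
  [/\ (forall x, T 0%R x = x),
      (forall m n x, T (m + n)%R x = T m (T n x)),
      (forall m, measurable_fun setT (T m)) &
      (forall m (A : set X), measurable A -> mu (T m @^-1` A) = mu A)].

Definition ergodic mu T : Prop :=
  forall A : set X, measurable A -> (forall m, T m @^-1` A = A) ->
    mu A = 0 \/ mu (~` A) = 0.

(* In the following definitions U g is the g-th iterate of the transformation,
   B j is the base and h j the height of the j-th tower, so that the set of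
   times of that tower is `I_(h j) = {0, ..., h j - 1}. *)

Definition levels_union k (U : nat -> X -> X) (B : 'I_k -> set X)
    (F : 'I_k -> set nat) : set X :=
  \bigcup_(j in [set: 'I_k]) \bigcup_(g in F j) (U g @` B j).

Definition tower (U : nat -> X -> X) (B : set X) (h : nat) : set X :=
  \bigcup_(g in `I_h) (U g @` B).

Definition levels_disjoint k (U : nat -> X -> X) (B : 'I_k -> set X)
    (h : 'I_k -> nat) : Prop :=
  trivIset [set p : 'I_k * nat | (p.2 < h p.1)%N]
    (fun p => U p.2 @` B p.1).

Definition approx_error mu k (U : nat -> X -> X) (B : 'I_k -> set X)
    (h : 'I_k -> nat) (A : set X) : \bar R :=
  ereal_inf [set mu (A `+` levels_union U B F) |
    F in [set F : 'I_k -> set nat | forall j, F j `<=` `I_(h j)]].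

(* A generating sequence of castles with k towers inside the measurable set Y,
   which stands for the measure space (Y, measurable subsets of Y, mu). *)
Definition castles mu Y (U : nat -> X -> X) k (B : nat -> 'I_k -> set X)
    (h : nat -> 'I_k -> nat) : Prop :=
  [/\ (forall n j, [/\ measurable (B n j), B n j `<=` Y, mu (B n j) < +oo &
                       (0 < h n j)%N]),
      (forall n, levels_disjoint U (B n) (h n)),
      (forall A : set X, measurable A -> A `<=` Y -> mu A < +oo ->
         (fun n => approx_error mu U (B n) (h n) A) @ \oo --> 0) &
      (forall j, (fun n => mu (B n j)) @ \oo --> 0)].

Definition zpow T (g : nat) : X -> X := T g%:Z.

Definition rank_castles mu T k (B : nat -> 'I_k -> set X)
    (h : nat -> 'I_k -> nat) : Prop :=
  castles mu setT (zpow T) B h.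

Definition rank_at_most mu T (k : nat) : Prop :=
  exists (B : nat -> 'I_k -> set X) (h : nat -> 'I_k -> nat),
    rank_castles mu T B h.

Definition castles_refine T k (B : nat -> 'I_k -> set X)
    (h : nat -> 'I_k -> nat) : Prop :=
  forall n j g, (g < h n j)%N ->
    exists2 F : 'I_k -> set nat, (forall i, F i `<=` `I_(h n.+1 i)) &
      zpow T g @` B n j = levels_union (zpow T) (B n.+1) F.

(* Invertible up to a null set.  Measurability of forward images makes the
   levels of the towers of S measurable. *)
Definition finite_mp_transformation mu Y S : Prop :=
  [/\ measurable Y /\ mu Y < +oo,
      (forall x, Y x -> Y (S x)),
      (forall A : set X, measurable A -> A `<=` Y ->
         measurable (Y `&` S @^-1` A) /\ measurable (S @` A)),
      (exists N : set X, [/\ measurable N, mu N = 0 &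
         forall x y, (Y `\` N) x -> (Y `\` N) y -> S x = S y -> x = y]) &
      (forall A : set X, measurable A -> A `<=` Y ->
         mu (Y `&` S @^-1` A) = mu A)].

Definition exact_rank_at_most mu Y S (k : nat) : Prop :=
  finite_mp_transformation mu Y S /\
  exists (D : nat -> 'I_k -> set X) (h : nat -> 'I_k -> nat),
    let U := fun g : nat => iter g S in
    let V := fun n j => tower U (D n j) (h n j) in
    [/\ castles mu Y U D h,
        (forall n, mu (Y `\` \bigcup_(j in [set: 'I_k]) V n j) = 0) &
        exists2 delta : R, (0 < delta)%R & forall n j, delta%:E < mu (V n j)].

Definition first_return_time S Y (x : X) (n : nat) : Prop :=
  [/\ (0 < n)%N, Y (iter n S x) &
      forall m, (0 < m < n)%N -> ~ Y (iter m S x)].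

(* First return map to Y.  Points that never return to Y are fixed (the default
   time is 0); by recurrence they form a null subset of Y. *)
Definition induced_map S Y (x : X) : X :=
  iter (xget 0%N [set n | first_return_time S Y x n]) S x.

End Definitions.

(* Main.v *)
(* By refinement, Y is a union of levels of every castle, so each level of the
   n-th castle lies in Y or misses Y. If g_0 < ... < g_(m-1) are the times of
   the j-th tower whose levels lie in Y, the first return map S carries
   T^(g_i) B_n^j onto T^(g_(i+1)) B_n^j; hence T^(g_0) B_n^j is the base of an
   S-tower of height m filling the intersection of Y with W_n^j. These towers
   fill Y and inherit the approximation property; their measures tend to
   delta_j > 0, so finitely many n have to be dropped. A point that never
   returns to Y lies in a last inner level for every n; as mu(B_n^j) tends to
   0, such points form a null set. Thus recurrence comes from the castles,
   without a conservativity argument. *)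

Require Import Defs.
From mathcomp Require Import all_boot all_order all_algebra.
From mathcomp Require Import all_classical all_reals all_analysis.
Set Implicit Arguments.
Unset Strict Implicit.
Unset Printing Implicit Defensive.

Import Order.TTheory GRing.Theory Num.Theory.
Import numFieldNormedType.Exports.
Local Open Scope classical_set_scope.
Local Open Scope ring_scope.
Local Open Scope ereal_scope.

(** * Finite unions of measurable sets and a criterion for null sets *)

Lemma bigcup_ord_bigsetU (T : Type) k (A : 'I_k -> set T) :
  \bigcup_(j in [set: 'I_k]) A j = \big[setU/set0]_(j < k) A j.
Proof.
rewrite -bigcup_seq; congr bigcup.
by apply/seteqP; split => j //= _; rewrite mem_index_enum.
Qed.

Section measure.
Context (R : realType) d (X : measurableType d).
Implicit Types (mu : {measure set X -> \bar R}).

Lemma measure_bigcup_ord_le mu k (A : 'I_k -> set X) :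
  (forall j, measurable (A j)) ->
  mu (\bigcup_(j in [set: 'I_k]) A j) <= \sum_(j < k) mu (A j).
Proof.
move=> mA; rewrite bigcup_ord_bigsetU.
elim: (index_enum _) => [|j s IH]; first by rewrite !big_nil measure0.
rewrite !big_cons (le_trans (measureU2 _ _ _)) ?leeD2l//.
exact: bigsetU_measurable.
Qed.

(** Serves to show that the points without return form a null set: subadditivity bounds [mu A] by a
    sum of [k] terms, and this sum tends to 0 because [k] does not depend on [n]. *)
Lemma measure_eq0_bigcup_cvg0 mu k (A : set X) (C : nat -> 'I_k -> set X) :
  measurable A -> (forall n j, measurable (C n j)) ->
  (forall n, A `<=` \bigcup_(j in [set: 'I_k]) C n j) ->
  (forall j, (fun n => mu (C n j)) @ \oo --> 0) -> mu A = 0.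
Proof.
move=> mA mC AC C0; apply/eqP; rewrite eq_le measure_ge0 andbT.
have mCn n : mu A <= \sum_(j < k) mu (C n j).
  apply: le_trans (measure_bigcup_ord_le _ (mC n)).
  by apply: le_measure; rewrite ?inE//; exact: fin_bigcup_measurable.
have -> : 0 = \sum_(j < k) (0 : \bar R) by rewrite big1.
have Cs : (fun n => \sum_(j < k) mu (C n j)) @ \oo --> \sum_(j < k) (0 : \bar R).
  by apply: cvg_nnesum => j _; [exact: nearW|exact: C0].
by apply: (cvge_ge _ Cs); apply: nearW => n; exact: mCn.
Qed.
End measure.

(** * Nonnegative powers of the action: bijectivity, measurability, invariance *)

Section zpow.
Context (R : realType) d (X : measurableType d) (mu : {measure set X -> \bar R}).
Context (T : int -> X -> X) (T_mp : mp_action mu T).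

Let T0 : forall x, T 0%R x = x. Proof. by case: T_mp. Qed.
Let TD : forall m n x, T (m + n)%R x = T m (T n x). Proof. by case: T_mp. Qed.

Lemma zpow0 x : zpow T 0 x = x.
Proof. exact: T0. Qed.

Lemma zpowD m n x : zpow T (m + n) x = zpow T m (zpow T n x).
Proof. by rewrite /zpow PoszD TD. Qed.

Lemma iter_zpow n x : iter n (T 1%R) x = zpow T n x.
Proof. elim: n => [|n IH]; first by rewrite zpow0.
by rewrite iterS IH; apply/esym; exact: (zpowD 1 n x). Qed.

Lemma zpowK n : cancel (zpow T n) (T (- n%:Z)%R).
Proof. by move=> x; rewrite /zpow -TD addNr T0. Qed.

Lemma zpowVK n : cancel (T (- n%:Z)%R) (zpow T n).
Proof. by move=> x; rewrite /zpow -TD addrN T0. Qed.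

Lemma zpow_inj n : injective (zpow T n).
Proof. exact: can_inj (zpowK n). Qed.

Lemma image_zpow n (A : set X) : zpow T n @` A = T (- n%:Z)%R @^-1` A.
Proof.
apply/seteqP; split => [_ [x Ax <-]|x Ax] /=; first by rewrite zpowK.
by exists (T (- n%:Z)%R x) => //; rewrite zpowVK.
Qed.

Lemma measurable_zpow_preimage n (A : set X) :
  measurable A -> measurable (zpow T n @^-1` A).
Proof.
by case: T_mp => _ _ Tm _ mA; rewrite -[_ @^-1` _]setTI; exact: Tm.
Qed.

Lemma measurable_zpow_image n (A : set X) :
  measurable A -> measurable (zpow T n @` A).
Proof.
case: T_mp => _ _ Tm _ mA; rewrite image_zpow -[_ @^-1` _]setTI; exact: Tm.
Qed.

Lemma measure_zpow_image n (A : set X) :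
  measurable A -> mu (zpow T n @` A) = mu A.
Proof. by case: T_mp => _ _ _ Tmu mA; rewrite image_zpow Tmu. Qed.

End zpow.

(** * The first return map to a measurable set *)

Section induced_map.
Context (R : realType) d (X : measurableType d) (mu : {measure set X -> \bar R}).
Context (T : int -> X -> X) (T_mp : mp_action mu T).
Context (Y : set X) (mY : measurable Y).

Local Notation S := (induced_map (T 1%R) Y).

Lemma first_return_time_uniq (U : X -> X) x m n :
  first_return_time U Y x m -> first_return_time U Y x n -> m = n.
Proof.
move=> [m0 Ym Ym'] [n0 Yn Yn'].
case: (ltngtP m n) => // lt.
- by case: (Yn' m) => //; rewrite m0.
- by case: (Ym' n) => //; rewrite n0.
Qed.

(** These are the pieces of [Y] on which [S] is a single power of [T]; measurability and invariance
    are checked piece by piece. *)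
Definition returning n := [set x | Y x /\ first_return_time (T 1%R) Y x n].

Definition never_returning := Y `\` \bigcup_n returning n.

Lemma induced_map_returning n x : returning n x -> S x = zpow T n x.
Proof.
move=> [Yx ret]; rewrite /induced_map (@xget_unique _ _ _ n)//.
  exact: iter_zpow T_mp _ _.
by move=> m retm; apply: first_return_time_uniq retm ret.
Qed.

Lemma induced_map_never x : never_returning x -> S x = x.
Proof.
move=> [Yx nx]; rewrite /induced_map xgetPN// => n ret.
by apply: nx; exists n.
Qed.

Lemma returning_or_never x : Y x -> never_returning x \/ exists n, returning n x.
Proof.
move=> Yx; have [[n _ ret]|nr] := pselect ((\bigcup_n returning n) x).
  by right; exists n.
by left.
Qed.

Lemma returning_zpow n x : returning n x -> Y (zpow T n x).
Proof. by move=> [_ [_ + _]]; rewrite (iter_zpow T_mp). Qed.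

Lemma measurable_returning n : measurable (returning n).
Proof.
case: n => [|n].
  rewrite (_ : returning 0 = set0)//.
  by apply/seteqP; split => x // [_ []].
rewrite (_ : returning n.+1 = (Y `&` zpow T n.+1 @^-1` Y) `\`
    \bigcup_(m in [set m | (0 < m < n.+1)%N]) zpow T m @^-1` Y).
  apply: measurableD;
    first by apply: measurableI => //; exact: (measurable_zpow_preimage T_mp).
  by apply: bigcup_measurable => m _; exact: (measurable_zpow_preimage T_mp).
apply/seteqP; split => x.
  move=> [Yx [_ Yn nY]]; rewrite (iter_zpow T_mp) in Yn; split => // -[m mn Ym].
  by apply: (nY m mn); rewrite (iter_zpow T_mp).
move=> [[Yx Yn] nY]; split => //; split => //; rewrite ?(iter_zpow T_mp)//.
by move=> m mn; rewrite (iter_zpow T_mp) => Ym; apply: nY; exists m.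
Qed.

Lemma measurable_never_returning : measurable never_returning.
Proof.
apply: measurableD => //; apply: bigcup_measurable => n _.
exact: measurable_returning.
Qed.

(** For [m <= n], cancelling [zpow T m] leaves [x = zpow T (n - m) y], a point of [Y]. Were [n - m]
    positive, [y] would be back in [Y] before time [n], as [m > 0]. *)
Lemma zpow_returning_inj m n x y : returning m x -> returning n y ->
  zpow T m x = zpow T n y -> m = n /\ x = y.
Proof.
wlog mn : m n x y / (m <= n)%N.
  move=> H; have [mn|/ltnW nm] := leqP m n; first exact: H.
  by move=> rm rn /esym e; have [] := H _ _ _ _ nm rn rm e.
move=> [Yx [m0 _ _]] [_ [_ _ nY]]; rewrite -(subnKC mn) (zpowD T_mp).
move=> /(zpow_inj T_mp) exy.
have [nm|nm] := posnP (n - m)%N.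
  by move: exy; rewrite nm (zpow0 T_mp) addn0.
have /nY[] : (0 < n - m < n)%N.
  by rewrite nm -[ltnRHS](subnK mn) -[ltnLHS]addn0 ltn_add2l.
by rewrite (iter_zpow T_mp) -exy.
Qed.

Lemma induced_map_inj x y : (Y `\` never_returning) x ->
  (Y `\` never_returning) y -> S x = S y -> x = y.
Proof.
move=> [/returning_or_never[//|[m rm]] _] [/returning_or_never[//|[n rn]] _].
rewrite (induced_map_returning rm) (induced_map_returning rn).
by case/(zpow_returning_inj rm rn).
Qed.

Lemma induced_map_in x : Y x -> Y (S x).
Proof.
move=> Yx; have [nx|[n rx]] := returning_or_never Yx.
  by rewrite induced_map_never.
by rewrite (induced_map_returning rx); exact: returning_zpow.
Qed.

(** Turns the preimage under [S] into a countable union built from powers of [T]; points that never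
    return are fixed and account for the first term. *)
Lemma preimage_induced_map (A : set X) : A `<=` Y ->
  Y `&` S @^-1` A = (never_returning `&` A) `|`
    \bigcup_n (returning n `&` zpow T n @^-1` A).
Proof.
move=> AY; apply/seteqP; split => x.
  move=> [Yx /= ASx]; have [nx|[n rx]] := returning_or_never Yx.
    by left; rewrite induced_map_never in ASx.
  by right; exists n => //; rewrite (induced_map_returning rx) in ASx.
move=> [[nx Ax]|[n _ [rx Ax]]];
    first by split; rewrite /= ?induced_map_never//; exact: AY.
by split; [case: rx|rewrite /= (induced_map_returning rx)].
Qed.

Lemma image_induced_map (A : set X) : A `<=` Y ->
  S @` A = (never_returning `&` A) `|`
    \bigcup_n (zpow T n @` (returning n `&` A)).
Proof.
move=> AY; apply/seteqP; split => x.
  move=> [y Ay <-]; have [ny|[n ry]] := returning_or_never (AY _ Ay).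
    by left; rewrite induced_map_never.
  by right; exists n => //; rewrite (induced_map_returning ry); exists y.
move=> [[nx Ax]|[n _ [y [ry Ay] <-]]].
  by exists x => //; rewrite induced_map_never.
by exists y => //; rewrite (induced_map_returning ry).
Qed.

Lemma measurable_preimage_induced_map (A : set X) : measurable A -> A `<=` Y ->
  measurable (Y `&` S @^-1` A).
Proof.
move=> mA AY; rewrite preimage_induced_map//; apply: measurableU.
  exact: measurableI measurable_never_returning mA.
apply: bigcup_measurable => n _; apply: measurableI.
  exact: measurable_returning.
exact: (measurable_zpow_preimage T_mp).
Qed.

Lemma measurable_image_induced_map (A : set X) : measurable A -> A `<=` Y ->
  measurable (S @` A).
Proof.
move=> mA AY; rewrite image_induced_map//; apply: measurableU.
  exact: measurableI measurable_never_returning mA.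
apply: bigcup_measurable => n _; apply: (measurable_zpow_image T_mp).
exact: measurableI (measurable_returning n) mA.
Qed.

(** Both unions are disjoint, the one of the pieces by uniqueness of the return time, the one of
    their images by [zpow_returning_inj]; termwise the measures agree since [T] preserves [mu]. *)
Lemma measure_bigcup_zpow (C : nat -> set X) :
  (forall n, measurable (C n)) -> (forall n, C n `<=` returning n) ->
  mu (\bigcup_n (zpow T n @` C n)) = mu (\bigcup_n C n).
Proof.
move=> mC Cr; rewrite !measure_bigcup//.
- by apply: eq_eseriesr => n _; rewrite (measure_zpow_image T_mp).
- move=> m n _ _ [x [/Cr[_ rm] /Cr[_ rn]]].
  exact: first_return_time_uniq rm rn.
- by move=> n _; exact: (measurable_zpow_image T_mp).
- move=> m n _ _ [_ [[x /Cr rx <-] [y /Cr ry /esym e]]].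
  by have [] := zpow_returning_inj rx ry e.
Qed.

(** For invariance, let W be the union of the forward images of the pieces [returning n]. It lies in
    [Y] and has the measure of [Y], so by finiteness its complement in [Y] is null. Up to null sets
    the preimage of [A] is moved, piece by piece, onto the intersection of [A] with W. *)
Lemma finite_mp_induced_map : mu Y < +oo -> mu never_returning = 0 ->
  finite_mp_transformation mu Y S.
Proof.
move=> Yfin N0; split => //.
- exact: induced_map_in.
- move=> A mA AY; split.
    exact: measurable_preimage_induced_map.
  exact: measurable_image_induced_map.
- exists never_returning; split => //; first exact: measurable_never_returning.
  exact: induced_map_inj.
move=> A mA AY.
have mR := measurable_returning; have mN := measurable_never_returning.
have mW : measurable (\bigcup_n (zpow T n @` returning n)).
  by apply: bigcup_measurable => n _; exact: (measurable_zpow_image T_mp).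
have WY : \bigcup_n (zpow T n @` returning n) `<=` Y.
  by move=> _ [n _ [x rx <-]]; exact: returning_zpow.
have mRT n : measurable (returning n `&` zpow T n @^-1` A).
  by apply: measurableI => //; exact: (measurable_zpow_preimage T_mp).
have muW : mu (\bigcup_n (zpow T n @` returning n)) = mu Y.
  rewrite (measure_bigcup_zpow mR (fun n => @subset_refl _ _)).
  rewrite -(@measureU0 _ _ _ mu _ never_returning)//; last first.
    exact: bigcup_measurable.
  congr (mu _); apply/seteqP; split => x.
    by move=> [[n _ []//]|[]].
  by case/returning_or_never => [nx|[n rx]]; [right|left; exists n].
have YW0 : mu (Y `\` \bigcup_n (zpow T n @` returning n)) = 0.
  rewrite measureD// setIidr//; transitivity (mu Y - mu Y).
    by congr (_ - _); exact: muW.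
  by rewrite subee// ge0_fin_numE.
(* The fixed part of the preimage is dropped as a subset of the null set [never_returning]; the
   other pieces are then moved forward into [A]. *)
rewrite preimage_induced_map// setUC measureU0; first last.
- apply: subset_measure0 N0 => //; exact: measurableI.
- exact: measurableI.
- exact: bigcup_measurable.
rewrite -measure_bigcup_zpow//.
(* What the forward images miss of [A] lies in the null set of [YW0]. *)
have AE : A = \bigcup_n (zpow T n @` (returning n `&` zpow T n @^-1` A)) `|`
    A `&` (Y `\` \bigcup_n (zpow T n @` returning n)).
  apply/seteqP; split => [x Ax|x [[n _ [y [_ Ay] <-]]|[]]//].
  have [[n _ [y ry xy]]|nx] :=
      pselect ((\bigcup_n (zpow T n @` returning n)) x).
    by left; exists n => //; exists y => //; split => //=; rewrite xy.
  by right; split => //; split => //; exact: AY.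
rewrite [in RHS]AE measureU0//.
- by apply: bigcup_measurable => n _; exact: (measurable_zpow_image T_mp).
- by apply: measurableI => //; exact: measurableD.
- apply: subset_measure0 YW0 => //; last exact: measurableD.
  by apply: measurableI => //; exact: measurableD.
Qed.
End induced_map.

(** * The castle of the first return map obtained from a single castle of [T] *)

Section induced_castle.
Context (R : realType) d (X : measurableType d) (mu : {measure set X -> \bar R}).
Context (T : int -> X -> X) (T_mp : mp_action mu T).
Context k (C : 'I_k -> set X) (h : 'I_k -> nat) (Y : set X).

Local Notation S := (induced_map (T 1%R) Y).

(** Kept as an increasing list, so that position [i] in the list becomes time [i] in the tower of
    [S]. *)
Definition inner_times j :=
  [seq g <- iota 0 (h j) | `[< zpow T g @` C j `<=` Y >]].

Definition inner_time j i := nth 0%N (inner_times j) i.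

(** If no level of the tower lies in [Y], the default 0 gives the base [C j], paired with height
    0. *)
Definition induced_base j := zpow T (inner_time j 0) @` C j.

Definition induced_height j := size (inner_times j).

Lemma mem_inner_times j g :
  (g \in inner_times j) = (g < h j)%N && `[< zpow T g @` C j `<=` Y >].
Proof. by rewrite mem_filter mem_iota add0n leq0n andbC. Qed.

Lemma inner_time_in j i :
  (i < induced_height j)%N -> inner_time j i \in inner_times j.
Proof. exact: mem_nth. Qed.

Lemma inner_time_lt j i : (i < induced_height j)%N -> (inner_time j i < h j)%N.
Proof. by move=> /inner_time_in; rewrite mem_inner_times => /andP[]. Qed.

Lemma inner_time_sub j i : (i < induced_height j)%N ->
  zpow T (inner_time j i) @` C j `<=` Y.
Proof. by move=> /inner_time_in; rewrite mem_inner_times => /andP[_ /asboolP]. Qed.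

Lemma inner_times_exists j g : g \in inner_times j ->
  exists2 i, (i < induced_height j)%N & inner_time j i = g.
Proof.
move=> gj; exists (index g (inner_times j));
  first by rewrite /induced_height index_mem.
exact: nth_index.
Qed.

Lemma inner_time_mono j i i' :
  (i < induced_height j)%N -> (i' < induced_height j)%N ->
  (i < i')%N -> (inner_time j i < inner_time j i')%N.
Proof.
move=> hi hi'; apply: (sorted_ltn_nth ltn_trans); rewrite ?inE//.
exact: (sorted_filter ltn_trans _ (iota_ltn_sorted _ _)).
Qed.

Lemma inner_time_inj j i i' :
  (i < induced_height j)%N -> (i' < induced_height j)%N ->
  inner_time j i = inner_time j i' -> i = i'.
Proof.
move=> hi hi' e; case: (ltngtP i i') => // /inner_time_mono.
- by move=> /(_ j hi hi'); rewrite e ltnn.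
- by move=> /(_ j hi' hi); rewrite e ltnn.
Qed.

Context (disj : levels_disjoint (zpow T) C h).
Context (YE : Y = levels_union (zpow T) C (fun j => [set` inner_times j])).

(** A level that meets [Y] lies in [Y]: the common point belongs to one of the levels composing [Y],
    and by disjointness that level is the given one. *)
Lemma inner_times_meet j g y : (g < h j)%N -> C j y -> Y (zpow T g y) ->
  g \in inner_times j.
Proof.
move=> gh Cy; rewrite {1}YE => -[i _ [g' /= g'i Cgy]].
have [] : (i, g') = (j, g).
  apply: disj => //=; first by move: g'i; rewrite mem_inner_times => /andP[].
  by exists (zpow T g y); split => //; exists y.
by move=> ij gg'; rewrite -ij -gg'.
Qed.

(** Between two consecutive inner times the orbit stays in levels of the tower that are not inner,
    and such levels miss [Y] by [inner_times_meet]. *)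
Lemma returning_inner_time j i y : (i.+1 < induced_height j)%N -> C j y ->
  returning T Y (inner_time j i.+1 - inner_time j i) (zpow T (inner_time j i) y).
Proof.
move=> hi Cy; have hi' := ltnW hi.
have lt := inner_time_mono hi' hi (ltnSn i).
split; first by apply: (inner_time_sub hi'); exists y.
split; first by rewrite subn_gt0.
  rewrite (iter_zpow T_mp) -(zpowD T_mp) subnK; last exact: ltnW.
  by apply: (inner_time_sub hi); exists y.
move=> m /andP[m0 mlt]; rewrite (iter_zpow T_mp) -(zpowD T_mp) => Ym.
rewrite ltn_subRL addnC in mlt.
(* An earlier visit to [Y] would occur at an inner time, of index [l] say. Monotonicity excludes
   [l <= i] because [m > 0], and [l > i] because [m] is less than the gap. *)
have /inner_times_exists[l hl le] : (m + inner_time j i)%N \in inner_times j.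
  by apply: (inner_times_meet _ Cy Ym); exact: (ltn_trans mlt (inner_time_lt hi)).
have [li|il] := leqP l i.
  move: li; rewrite leq_eqVlt => /orP[/eqP li|/(inner_time_mono hl hi')].
    by move: m0; rewrite -(ltn_add2r (inner_time j i)) -le li add0n ltnn.
  by rewrite le ltnNge leq_addl.
move: il; rewrite leq_eqVlt => /orP[/eqP li|/(inner_time_mono hi hl)].
  by move: mlt; rewrite -le -li ltnn.
by rewrite le ltnNge ltnW.
Qed.

Lemma iter_induced_map j i y : (i < induced_height j)%N -> C j y ->
  iter i S (zpow T (inner_time j 0) y) = zpow T (inner_time j i) y.
Proof.
move=> + Cy; elim: i => // i IH hi; rewrite iterS IH; last exact: ltnW.
rewrite (induced_map_returning T_mp (returning_inner_time hi Cy)) -(zpowD T_mp) subnK//.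
exact/ltnW/(inner_time_mono (ltnW hi) hi).
Qed.

Lemma iter_image_induced_base j i : (i < induced_height j)%N ->
  iter i S @` induced_base j = zpow T (inner_time j i) @` C j.
Proof.
move=> hi; apply/seteqP; split => z.
  by move=> [_ [y Cy <-] <-]; exists y => //; rewrite iter_induced_map.
move=> [y Cy <-]; exists (zpow T (inner_time j 0) y); first by exists y.
exact: iter_induced_map.
Qed.

Lemma bigcup_induced_base j (F : set nat) :
  \bigcup_(i in [set i | (i < induced_height j)%N /\ F (inner_time j i)])
     (iter i S @` induced_base j) =
  \bigcup_(g in [set` inner_times j] `&` F) (zpow T g @` C j).
Proof.
apply/seteqP; split => x.
  move=> [i [hi Fi]]; rewrite iter_image_induced_base// => Cx.
  by exists (inner_time j i) => //; split => //=; exact: inner_time_in.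
move=> [g [/= /inner_times_exists[i hi <-] Fi Cx]].
by exists i => //; rewrite iter_image_induced_base.
Qed.

(** Pulling the times in [F j] back along [inner_time j] selects exactly the inner levels among
    them, so the approximations by levels of [T] transfer to [S] after cutting with [Y]. *)
Lemma levels_union_induced_base (F : 'I_k -> set nat) :
  levels_union (fun g => iter g S) induced_base
    (fun j => [set i | (i < induced_height j)%N /\ F j (inner_time j i)]) =
  levels_union (zpow T) C (fun j => [set` inner_times j] `&` F j).
Proof. by apply: eq_bigcupr => j _; exact: bigcup_induced_base. Qed.

Lemma levels_union_inner (F : 'I_k -> set nat) : (forall j, F j `<=` `I_(h j)) ->
  levels_union (zpow T) C (fun j => [set` inner_times j] `&` F j) =
  Y `&` levels_union (zpow T) C F.
Proof.
move=> Fh; apply/seteqP; split => x.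
  move=> [j _ [g [/= gj Fg] Cx]]; split; last by exists j => //; exists g.
  by rewrite YE; exists j => //; exists g.
move=> [Yx [j _ [g Fg [y Cy yx]]]]; exists j => //; exists g; last by exists y.
split => //=; apply: (inner_times_meet _ Cy); first exact: Fh.
by rewrite yx.
Qed.

Lemma tower_induced_base j :
  tower (fun g => iter g S) (induced_base j) (induced_height j) =
  Y `&` tower (zpow T) (C j) (h j).
Proof.
rewrite (_ : tower _ _ (induced_height j) =
    \bigcup_(g in [set` inner_times j] `&` setT) (zpow T g @` C j)).
  rewrite setIT; apply/seteqP; split => x.
    move=> [g /= gj Cx]; split; first by rewrite YE; exists j => //; exists g.
    by exists g => //=; move: gj; rewrite mem_inner_times => /andP[].
  move=> [Yx [g gh [y Cy yx]]]; exists g; last by exists y.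
  by apply: (inner_times_meet gh Cy); rewrite yx.
by rewrite -bigcup_induced_base; congr bigcup; apply/seteqP; split => i //= [].
Qed.

Lemma bigcup_tower_induced_base :
  \bigcup_(j in [set: 'I_k]) tower (fun g => iter g S) (induced_base j)
    (induced_height j) = Y.
Proof.
apply/seteqP; split => [x [j _]|x Yx]; first by rewrite tower_induced_base => -[].
move: (Yx); rewrite {1}YE => -[j _ [g gj Cx]]; exists j => //.
rewrite tower_induced_base; split => //; exists g => //=.
by move: gj; rewrite /= mem_inner_times => /andP[].
Qed.

Lemma levels_disjoint_induced_base :
  levels_disjoint (fun g => iter g S) induced_base induced_height.
Proof.
move=> [j i] [j' i'] /= hi hi'; rewrite !iter_image_induced_base// => meet.
have [jj ii] : (j, inner_time j i) = (j', inner_time j' i').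
  by apply: disj => //=; exact: inner_time_lt.
by rewrite -jj in hi' ii *; rewrite (inner_time_inj hi hi' ii).
Qed.

(** A point in an inner level other than the last of its tower returns to [Y] by
    [returning_inner_time]. The default in [last] can only enlarge the right-hand side, by the base
    of a tower without inner levels. *)
Lemma never_returning_sub : never_returning T Y `<=`
  \bigcup_(j in [set: 'I_k]) (zpow T (last 0%N (inner_times j)) @` C j).
Proof.
move=> x [Yx nx]; move: (Yx); rewrite {1}YE => -[j _ [g gj [y Cy yx]]].
exists j => //; exists y => //; rewrite -yx; congr zpow.
have [i hi gi] := inner_times_exists gj; rewrite -nth_last -gi.
have [lt|] := ltnP i.+1 (induced_height j).
  exfalso; apply: nx; exists (inner_time j i.+1 - inner_time j i)%N => //.
  by rewrite -yx -gi; exact: returning_inner_time.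
move=> le; rewrite (_ : size _ = i.+1)//.
by apply/eqP; rewrite eqn_leq le.
Qed.

Lemma measurable_induced_base j :
  (forall j, measurable (C j)) -> measurable (induced_base j).
Proof. by move=> mC; exact: (measurable_zpow_image T_mp). Qed.

(** As [A] lies in [Y], cutting an approximating union of levels with [Y] shrinks its symmetric
    difference with [A], and the cut set is a union of levels of the castle of [S]. *)
Lemma approx_error_induced_base (A : set X) : (forall j, measurable (C j)) ->
  measurable A -> A `<=` Y ->
  approx_error mu (fun g => iter g S) induced_base induced_height A <=
  approx_error mu (zpow T) C h A.
Proof.
move=> mC mA AY; apply: le_ereal_inf_tmp => _ [F Fh <-].
have mU F' : measurable (levels_union (zpow T) C F').
  apply: fin_bigcup_measurable => // j _; apply: bigcup_measurable => g _.
  exact: (measurable_zpow_image T_mp).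
apply: (@le_trans _ _ (mu (A `+` (Y `&` levels_union (zpow T) C F)))).
  apply: ereal_inf_lbound.
  exists (fun j => [set i | (i < induced_height j)%N /\ F j (inner_time j i)]).
    by move=> j i [].
  by rewrite levels_union_induced_base levels_union_inner.
have mY : measurable Y by rewrite YE.
apply: le_measure; rewrite ?inE.
- by apply: measurableU; apply: measurableD => //; exact: measurableI.
- by apply: measurableU; exact: measurableD.
- move=> x [[Ax nx]|[[Yx Ux] nAx]]; [left|by right].
  by split => // Ux; apply: nx; split => //; exact: AY.
Qed.

End induced_castle.

(** * Passage along the refining sequence and assembly of exact rank *)

Lemma levels_union_refine d (X : measurableType d)
    (T : int -> X -> X) k (B : nat -> 'I_k -> set X) (h : nat -> 'I_k -> nat) Y n :
  castles_refine T B h ->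
  Y = levels_union (zpow T) (B 0%N)
    (fun j => [set` inner_times T (B 0%N) (h 0%N) Y j]) ->
  Y = levels_union (zpow T) (B n)
    (fun j => [set` inner_times T (B n) (h n) Y j]).
Proof.
move=> refine Y0; elim: n => // n IH; apply/seteqP; split => x.
  (* The sublevels of a level inside [Y] are themselves inside [Y], hence inner in the next
     castle. *)
  rewrite {1}IH => -[j _ [g gj Bx]]; move: gj.
  rewrite /= mem_inner_times => /andP[gh /asboolP gY].
  have [F Fh gE] := refine _ _ _ gh; move: Bx; rewrite gE => -[i _ [g' Fg' Bx]].
  exists i => //; exists g' => //=; rewrite mem_inner_times; apply/andP; split.
    exact: Fh _ Fg'.
  apply/asboolP; apply: subset_trans gY; rewrite gE => z Cz.
  by exists i => //; exists g'.
by move=> [j _ [g /=]]; rewrite mem_inner_times => /andP[_ /asboolP]; apply.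
Qed.

Unset Implicit Arguments.

Theorem corollary3p5 (R : realType) (d : measure_display)
  (X : measurableType d) (mu : {sigma_finite_measure set X -> \bar R})
  (T : int -> X -> X) (k1 k : nat)
  (B : nat -> 'I_k -> set X) (h : nat -> 'I_k -> nat) (delta : 'I_k -> R)
  (X_standard : standard_borel R X)
  (mu_nonatomic : nonatomic mu)
  (T_mp : mp_action mu T)
  (T_ergodic : ergodic mu T)
  (T_rank : rank_at_most mu T k1)
  (k_range : (0 < k <= k1)%N)
  (B_castles : rank_castles mu T B h)
  (B_refine : castles_refine T B h)
  (delta_gt0 : forall j, (0 < delta j)%R)
  (delta_lim : forall j,
    (fun n => mu ((\bigcup_(i in [set: 'I_k]) B 0%N i) `&`
                  tower (zpow T) (B n j) (h n j))) @ \oo --> (delta j)%:E)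
  (delta_sum : \sum_(j < k) (delta j)%:E = \sum_(j < k) mu (B 0%N j)) :
  let Y := \bigcup_(i in [set: 'I_k]) B 0%N i in
  exact_rank_at_most mu Y (induced_map (T 1%R) Y) k.
Proof.
move=> Y; have [Bp Bdisj Bapprox B0] := B_castles.
have mB n j : measurable (B n j) by have [] := Bp n j.
have mY : measurable Y by exact: fin_bigcup_measurable.
have Yfin : mu Y < +oo.
  apply: le_lt_trans (measure_bigcup_ord_le _ (mB 0%N)) _.
  by apply: lte_sum_pinfty => j _; have [] := Bp 0%N j.
have YE n : Y = levels_union (zpow T) (B n)
    (fun j => [set` inner_times T (B n) (h n) Y j]).
  apply: (levels_union_refine n B_refine).
  apply/seteqP; split => x.
    (* In the initial castle the bases composing [Y] are the levels at time 0, which is an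
       admissible time because heights are positive. *)
    move=> [j _ Bx]; exists j => //; exists 0%N; last first.
      by exists x => //; exact: (zpow0 T_mp).
    rewrite /= mem_inner_times; have [_ _ _ ->] := Bp 0%N j.
    by apply/asboolP => _ [y By <-]; rewrite (zpow0 T_mp); exists j.
  by move=> [j _ [g /=]]; rewrite mem_inner_times => /andP[_ /asboolP]; apply.
pose D n := induced_base T (B n) (h n) Y.
pose H n := induced_height T (B n) (h n) Y.
have never0 : mu (never_returning T Y) = 0.
  apply: (measure_eq0_bigcup_cvg0 _ _
    (fun n => never_returning_sub T_mp (Bdisj n) (YE n))).
  - exact: (measurable_never_returning T_mp).
  - by move=> n j; exact: (measurable_zpow_image T_mp).
  - move=> j; apply: cvg_trans (B0 j); apply: near_eq_cvg.
    by apply: nearW => n; rewrite (measure_zpow_image T_mp).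
split; first exact: (finite_mp_induced_map T_mp).
have [e e0 eB] : exists2 e : R, (0 < e)%R & forall j, (e < delta j)%R.
  (* The initial value 1 keeps the minimum positive; halving makes the inequality strict, as needed
     to pass from the limits to all large [n]. *)
  exists (\big[Order.min/1]_j delta j / 2)%R.
    rewrite divr_gt0//; elim/big_ind: _ => // x y x0 y0.
    by rewrite lt_min x0.
  move=> j; rewrite ltr_pdivrMr//; apply: (@le_lt_trans _ _ (delta j)).
    exact: bigmin_le_cond.
  by rewrite ltr_pMr// ltr1n.
(* A single [N] serves all towers, there being finitely many of them. *)
have [N _ NP] : \forall n \near \oo, forall j,
    e%:E < mu (Y `&` tower (zpow T) (B n j) (h n j)).
  apply: filter_forall => j.
  have /open_ereal_gt' : e%:E < (delta j)%:E by rewrite lte_fin.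
  exact: (delta_lim j).
(* A tower of height 0 is empty, which contradicts the lower bound [e] on its measure. *)
have HP n j : (N <= n)%N -> (0 < H n j)%N.
  move=> Nn; rewrite lt0n; apply/eqP => H0; have := NP n Nn j.
  rewrite -(tower_induced_base T_mp (Bdisj n) (YE n)).
  rewrite -/(H n j) H0 /tower [X in mu X](_ : _ = set0) ?measure0.
    by rewrite lte_fin ltNge ltW.
  by apply/seteqP; split => x // [].
(* The shift by [N] discards the castles for which the height may vanish or the bound [e] may
   fail. *)
exists (fun n => D (n + N)%N), (fun n => H (n + N)%N) => U V.
have NE n : (N <= n + N)%N by exact: leq_addl.
split.
- split.
  + move=> n j; split.
    * exact: (measurable_induced_base T_mp).
    * exact: inner_time_sub (HP _ _ (NE n)).
    * by rewrite (measure_zpow_image T_mp)//; have [] := Bp (n + N)%N j.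
    * exact: HP.
  + by move=> n; exact: (levels_disjoint_induced_base T_mp (Bdisj _) (YE _)).
  + move=> A mA AY Afin.
    have := Bapprox A mA (@subsetT _ _) Afin; rewrite -(cvg_shiftn N).
    (* The error for [S] is squeezed between 0 and the error for the shifted castles of [T]. *)
    move=> approx0; apply: (squeeze_cvge _ (cvg_cst 0) approx0).
    apply: nearW => n; apply/andP; split.
      by apply: le_ereal_inf_tmp => _ [F _ <-].
    exact: (approx_error_induced_base T_mp (Bdisj _) (YE _)).
  + move=> j; have := B0 j; rewrite -(cvg_shiftn N).
    apply: cvg_trans; apply: near_eq_cvg.
    by apply: nearW => n; rewrite (measure_zpow_image T_mp).
- move=> n.
  by rewrite (bigcup_tower_induced_base T_mp (Bdisj _) (YE _)) setDv measure0.
- exists e => // n j.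
  by rewrite /V (tower_induced_base T_mp (Bdisj _) (YE _)); exact: NP _ (NE n) j.
Qed.
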